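(* Let $\pi:\mathcal{X}\to\mathcal{B}$ be a fibration, and let $\pi^{*}:\mathcal{X}^{*}\to\mathcal{B}$ be its fibrewise dual, whose arrows are equivalence classes of vh spans in $\mathcal{X}$. Then the functor $\pi^{*}:\mathcal{X}^{*}\to\mathcal{B}$ is a fibration over $\mathcal{B}$.
   Context: Composition of arrows is written from left to right: $f.g$ means first $f$, then $g$. Cartesian and vertical arrows; fibrations. Let $\pi:\mathcal{X}\to\mathcal{B}$ be a functor. For $\alpha:A\to B$ in $\mathcal{B}$ and objects $X,Y$ of $\mathcal{X}$ with $\pi(X)=A$, $\pi(Y)=B$, let $\hom_{\alpha}(X,Y)$ be the set of arrows $h:X\to Y$ with $\pi(h)=\alpha$. An arrow $h\in\hom_\alpha(X,Y)$ is cartesian (with respect to $\pi$) if for every arrow $\xi:C\to A$ in $\mathcal{B}$ and every object $Z$ with $\pi(Z)=C$, the map $\hom_{\xi}(Z,X)\to\hom_{\xi.\alpha}(Z,Y)$, $k\mapsto k.h$, is a bijection. The functor $\pi$ is a fibration if for every $\alpha:A\to B$ in $\mathcal{B}$ and every $Y$ with $\pi(Y)=B$ there is a cartesian arrow over $\alpha$ with codomain $Y$. An arrow of $\mathcal{X}$ is vertical if $\pi$ maps it to an identity arrow. The category $\mathcal{X}^{*}$. Let $\pi:\mathcal{X}\to\mathcal{B}$ be a fibration. A vh span in $\mathcal{X}$ from $X$ to $Y$ is a pair $(v,h)$ of arrows of $\mathcal{X}$ with common domain, where $v$ is vertical with codomain $X$ and $h$ is cartesian with codomain $Y$. Two vh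 spans $(v,h)$, $(v',h')$ from $X$ to $Y$ are equivalent, $(v,h)\equiv(v',h')$, if there is a vertical isomorphism $i$ in $\mathcal{X}$ with $i.v=v'$ and $i.h=h'$; the equivalence class of $(v,h)$ is denoted $\{(v,h)\}$. The category $\mathcal{X}^{*}$ has the same objects as $\mathcal{X}$, and its arrows $X\to Y$ are the equivalence classes of vh spans from $X$ to $Y$. For $\{(v_1,h_1)\}:X\to Y$ and $\{(v_2,h_2)\}:Y\to Z$, the composite is $\{(v_1,h_1)\}.\{(v_2,h_2)\}:=\{(w.v_1,\,k.h_2)\}$, where $k$ is a cartesian arrow over $\pi(h_1)$ whose codomain is the domain of $v_2$, and $w$ is the unique vertical arrow with $w.h_1=k.v_2$ (this is independent of the choices). The identity on $X$ is $\{(1_X,1_X)\}$. The functor $\pi^{*}:\mathcal{X}^{*}\to\mathcal{B}$ agrees with $\pi$ on objects, and $\pi^{*}(\{(v,h)\})=\pi(h)$. *)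

(* Defs.v *)
From mathcomp Require Import all_boot.
From mathcomp Require Import boolp classical_sets functions.

Set Implicit Arguments.
Unset Strict Implicit.
Unset Printing Implicit Defensive.

Declare Scope category_scope.
Delimit Scope category_scope with cat.
Local Open Scope classical_set_scope.
Local Open Scope category_scope.

(* Composition is in diagrammatic order: [f \; g] is first [f], then [g]. *)
Record category := Category {
  ob :> Type;
  hom : ob -> ob -> Type;
  idm : forall X, hom X X;
  compm : forall X Y Z, hom X Y -> hom Y Z -> hom X Z;
  comp1m : forall X Y (f : hom X Y), compm (idm X) f = f;
  compm1 : forall X Y (f : hom X Y), compm f (idm Y) = f;
  compmA : forall X Y Z T (f : hom X Y) (g : hom Y Z) (h : hom Z T),
    compm f (compm g h) = compm (compm f g) h }.

Arguments hom {c} X Y.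
Arguments idm {c} X.
Arguments compm {c X Y Z} f g.
Notation "f \; g" := (compm f g) : category_scope.

Record functor (X B : category) := Functor {
  fob :> X -> B;
  fmap : forall x y : X, hom x y -> hom (fob x) (fob y);
  fmap1 : forall x : X, fmap (idm x) = idm (fob x);
  fmapM : forall (x y z : X) (f : hom x y) (g : hom y z),
    fmap (f \; g) = fmap f \; fmap g }.

Arguments fmap {X B} _ {x y} _.

Definition iso (X : category) (x y : X) (f : hom x y) : Prop :=
  exists g : hom y x, f \; g = idm x /\ g \; f = idm y.

Section Fibrations.
Variables (X B : category) (pi : functor X B).

(* [over h a] is the equation pi(h) = a between arrows of B whose domains and
   codomains are not syntactically the same; it entails pi(x) = A and
   pi(y) = A', where h : x -> y and a : A -> A'. *)
Variant over (x y : X) (h : hom x y) : forall A A' : B, hom A A' -> Prop :=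
  Over : over h (fmap pi h).

Definition hom_over (A A' : B) (a : hom A A') (x y : X) : set (hom x y) :=
  [set h | over h a].
Arguments hom_over {A A'} a x y.

Definition cartesian (x y : X) (h : hom x y) : Prop :=
  forall (C : B) (xi : hom C (pi x)) (z : X), pi z = C ->
    set_bij (hom_over xi z x) (hom_over (xi \; fmap pi h) z y)
            (fun k : hom z x => k \; h).

Definition fibration : Prop :=
  forall (A A' : B) (a : hom A A') (y : X), pi y = A' ->
    exists (x : X) (h : hom x y), over h a /\ cartesian h.

Definition vertical (x y : X) (v : hom x y) : Prop :=
  exists A : B, over v (idm A).

End Fibrations.

Arguments over {X B} pi {x y} h {A A'} a.
Arguments hom_over {X B} pi {A A'} a x y.
Arguments cartesian {X B} pi {x y} h.
Arguments vertical {X B} pi {x y} v.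

Section OverTheory.
Variables (X B : category) (pi : functor X B).

Lemma over_fmap (x y : X) (h : hom x y) : over pi h (fmap pi h).
Proof. by []. Qed.

Lemma over_ob (x y : X) (h : hom x y) (A A' : B) (a : hom A A') :
  over pi h a -> pi x = A /\ pi y = A'.
Proof. by case. Qed.

Let tr (A A' C C' : B) (p : A = A') (q : C = C') (a : hom A C) : hom A' C' :=
  let: erefl := p in let: erefl := q in a.

Lemma over_inj (x y : X) (h : hom x y) (A A' : B) (a b : hom A A') :
  over pi h a -> over pi h b -> a = b.
Proof.
have tr_over C C' (c : hom C C') : over pi h c ->
    exists (p : pi x = C) (q : pi y = C'), c = tr p q (fmap pi h).
  by case; exists erefl, erefl.
move=> /tr_over[p [q ->]] /tr_over[p' [q' ->]].
by rewrite (Prop_irrelevance p p') (Prop_irrelevance q q').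
Qed.

Lemma overE (x y : X) (h : hom x y) (a : hom (pi x) (pi y)) :
  over pi h a -> fmap pi h = a.
Proof. exact: over_inj (over_fmap h). Qed.

Lemma over_trans (x y x' y' : X) (h : hom x y) (k : hom x' y')
    (A A' C C' : B) (a : hom A A') (b : hom C C') :
  over pi h a -> over pi h b -> over pi k a -> over pi k b.
Proof. by move=> [] []. Qed.

Lemma over_comp (x y z : X) (h : hom x y) (k : hom y z) (A A' A'' : B)
    (a : hom A A') (b : hom A' A'') :
  over pi h a -> over pi k b -> over pi (h \; k) (a \; b).
Proof.
move=> ha kb; have [Ax Ay] := over_ob ha; have [_ Az] := over_ob kb.
move: a b ha kb; case: A / Ax; case: A' / Ay; case: A'' / Az => a b.
by move=> /overE <- /overE <-; rewrite -fmapM.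
Qed.

Lemma over_idm (x : X) : over pi (idm x) (idm (pi x)).
Proof. by rewrite -(fmap1 pi). Qed.

Lemma vertical_dom (x y : X) (v : hom x y) :
  vertical pi v -> over pi v (idm (pi x)).
Proof. by case=> A vA; have [-> _] := over_ob vA. Qed.

Lemma vertical_cod (x y : X) (v : hom x y) :
  vertical pi v -> over pi v (idm (pi y)).
Proof. by case=> A vA; have [_ ->] := over_ob vA. Qed.

Lemma over_verticall (x y z : X) (v : hom x y) (h : hom y z) (A A' : B)
    (a : hom A A') :
  vertical pi v -> over pi h a -> over pi (v \; h) a.
Proof.
move=> /vertical_cod vv ha; rewrite -(comp1m a); apply: (over_comp _ ha).
by have [<- _] := over_ob ha.
Qed.

Lemma over_verticalr (x y z : X) (h : hom x y) (v : hom y z) (A A' : B)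
    (a : hom A A') :
  vertical pi v -> over pi h a -> over pi (h \; v) a.
Proof.
move=> /vertical_dom vv ha; rewrite -(compm1 a); apply: (over_comp ha).
by have [_ <-] := over_ob ha.
Qed.

Lemma vertical_idm (x : X) : vertical pi (idm x).
Proof. by exists (pi x); apply: over_idm. Qed.

Lemma vertical_comp (x y z : X) (v : hom x y) (w : hom y z) :
  vertical pi v -> vertical pi w -> vertical pi (v \; w).
Proof. by move=> vv [A wA]; exists A; apply: over_verticall. Qed.

Lemma vertical_inv (x y : X) (i : hom x y) (j : hom y x) :
  i \; j = idm x -> vertical pi i -> vertical pi j.
Proof.
move=> ij vi; exists (pi x).
have := over_verticall vi (over_fmap j); rewrite ij => jx.
exact: (over_trans jx (over_idm x) (over_fmap j)).
Qed.

Lemma cart_lift (x y z : X) (h : hom x y) (g : hom z y) (A A' C : B)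
    (a : hom A A') (xi : hom C A) :
  cartesian pi h -> over pi h a -> over pi g (xi \; a) ->
  exists2 k : hom z x, over pi k xi & k \; h = g.
Proof.
move=> hc ha; case: ha xi => xi gxi; have [zC _] := over_ob gxi.
by have [_ _ /(_ g gxi)[k kxi <-]] := hc _ xi _ zC; exists k.
Qed.

Lemma cart_inj (x y z : X) (h : hom x y) (k k' : hom z x) (A C : B)
    (xi : hom C A) :
  cartesian pi h -> over pi k xi -> over pi k' xi -> k \; h = k' \; h -> k = k'.
Proof.
move=> hc kxi k'xi; have [zC xA] := over_ob kxi.
case: A / xA xi kxi k'xi => xi kxi k'xi.
by have [_ + _] := hc _ xi _ zC; apply; rewrite inE.
Qed.

Lemma cartesianI (x y : X) (h : hom x y) :
  (forall (C : B) (xi : hom C (pi x)) z (g : hom z y),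
     over pi g (xi \; fmap pi h) ->
     exists2 k : hom z x, over pi k xi & k \; h = g) ->
  (forall (C : B) (xi : hom C (pi x)) z (k k' : hom z x),
     over pi k xi -> over pi k' xi -> k \; h = k' \; h -> k = k') ->
  cartesian pi h.
Proof.
move=> ex inj C xi z _; split.
- by move=> k /= kxi; apply: over_comp.
- by move=> k k'; rewrite !inE /=; apply: inj.
- by move=> g /= /ex[k kxi <-]; exists k.
Qed.

Lemma cart_idm (x : X) : cartesian pi (idm x).
Proof.
apply: cartesianI => [C xi z g|C xi z k k' _ _]; last by rewrite !compm1.
by rewrite fmap1 compm1 => gxi; exists g; rewrite ?compm1.
Qed.

Lemma cart_comp (x y z : X) (h : hom x y) (k : hom y z) :
  cartesian pi h -> cartesian pi k -> cartesian pi (h \; k).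
Proof.
move=> hc kc; apply: cartesianI => [C xi t g|C xi t l l' lxi l'xi].
  rewrite fmapM compmA => /(cart_lift kc (over_fmap k))[l + <-].
  by move=> /(cart_lift hc (over_fmap h))[m mxi <-]; exists m; rewrite ?compmA.
rewrite !compmA => e; apply: (cart_inj hc lxi l'xi).
apply: (cart_inj kc _ _ e); first exact: over_comp lxi (over_fmap h).
exact: over_comp l'xi (over_fmap h).
Qed.

Lemma cart_cancel (x y z : X) (h : hom x y) (k : hom y z) :
  cartesian pi (h \; k) -> cartesian pi k -> cartesian pi h.
Proof.
move=> hkc kc; apply: cartesianI => [C xi t g gxi|C xi t l l' lxi l'xi e].
  have := over_comp gxi (over_fmap k); rewrite -compmA -fmapM.
  move=> /(cart_lift hkc (over_fmap _))[l lxi e]; exists l => //.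
  apply: (cart_inj kc _ gxi); last by rewrite -compmA.
  exact: over_comp (over_fmap h).
by apply: (cart_inj hkc lxi l'xi); rewrite !compmA e.
Qed.

Lemma cart_iso (x y : X) (i : hom x y) : iso i -> cartesian pi i.
Proof.
case=> j [ij ji]; apply: cartesianI => [C xi z g gxi|C xi z k k' _ _ e].
  exists (g \; j); last by rewrite -compmA ji compm1.
  have := over_comp gxi (over_fmap j).
  by rewrite -compmA -fmapM ij fmap1 compm1.
by rewrite -(compm1 k) -ij compmA e -compmA ij compm1.
Qed.

Lemma cart_vertical_iso (x y : X) (j : hom x y) :
  vertical pi j -> cartesian pi j -> iso j.
Proof.
move=> jv jc; have jy := vertical_cod jv.
have [i iv ij] : exists2 i, over pi i (idm (pi y)) & i \; j = idm y.
  by apply: (cart_lift jc jy); rewrite comp1m; apply: over_idm.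
exists i; split=> //; apply: (cart_inj jc (xi := idm (pi x))).
- by apply: vertical_dom; apply: vertical_comp => //; exists (pi y).
- exact: over_idm.
- by rewrite -compmA ij compm1 comp1m.
Qed.

End OverTheory.

Arguments cart_idm {X B} pi x.

Section FibrewiseDual.
Variables (X B : category) (pi : functor X B).

Record vhspan (x y : X) := VHSpan {
  apex : X;
  vleg : hom apex x;
  hleg : hom apex y;
  vlegP : vertical pi vleg;
  hlegP : cartesian pi hleg }.
Arguments vlegP {x y} s : rename.
Arguments hlegP {x y} s : rename.

Lemma over_hleg (x y : X) (s : vhspan x y) :
  exists a : hom (pi x) (pi y), over pi (hleg s) a.
Proof.
have [ux _] := over_ob (vertical_cod (vlegP s)).
by case: _ / ux; exists (fmap pi (hleg s)).
Qed.

Definition vhspan_equiv (x y : X) (s s' : vhspan x y) : Prop :=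
  exists i : hom (apex s') (apex s),
    [/\ vertical pi i, iso i, i \; vleg s = vleg s' & i \; hleg s = hleg s'].

Lemma vhspan_equiv_refl (x y : X) (s : vhspan x y) : vhspan_equiv s s.
Proof.
exists (idm _); rewrite !comp1m; split=> //; first exact: vertical_idm.
by exists (idm _); rewrite comp1m.
Qed.

Lemma vhspan_equiv_sym (x y : X) (s s' : vhspan x y) :
  vhspan_equiv s s' -> vhspan_equiv s' s.
Proof.
case=> i [iv [j [ij ji]] ev eh]; exists j.
rewrite -ev -eh !compmA ji !comp1m.
by split=> //; [apply: vertical_inv ij iv | exists i].
Qed.

Lemma vhspan_equiv_trans (x y : X) (s s' s'' : vhspan x y) :
  vhspan_equiv s s' -> vhspan_equiv s' s'' -> vhspan_equiv s s''.
Proof.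
case=> i [iv [j [ij ji]] ev eh] [i' [i'v [j' [i'j' j'i']] ev' eh']].
exists (i' \; i); rewrite -ev' -eh' -ev -eh !compmA.
split=> //; first exact: vertical_comp.
exists (j \; j'); split.
  by rewrite -compmA (compmA i) ij comp1m.
by rewrite -compmA (compmA j') j'i' comp1m.
Qed.

Definition is_vhclass (x y : X) (c : set (vhspan x y)) : Prop :=
  exists s, c = [set s' | vhspan_equiv s s'].

Definition dual_hom (x y : X) : Type := {c : set (vhspan x y) | is_vhclass c}.

Definition vhclass (x y : X) (s : vhspan x y) : dual_hom x y :=
  exist _ [set s' | vhspan_equiv s s'] (ex_intro _ s erefl).

Lemma dual_hom_inj (x y : X) (f g : dual_hom x y) : sval f = sval g -> f = g.
Proof. by case: f g => [c cP] [c' c'P] /=; apply: eq_exist. Qed.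

Lemma vhclassP (x y : X) (f : dual_hom x y) : exists s, f = vhclass s.
Proof. by have [s e] := svalP f; exists s; apply: dual_hom_inj. Qed.

Lemma vhclass_eq (x y : X) (s s' : vhspan x y) :
  vhclass s = vhclass s' <-> vhspan_equiv s s'.
Proof.
split=> [/(congr1 sval)/= e|ss'].
  suff : [set t | vhspan_equiv s t] s' by [].
  by rewrite e; apply: vhspan_equiv_refl.
apply: dual_hom_inj; apply/seteqP; split=> t /=; apply: vhspan_equiv_trans => //.
exact: vhspan_equiv_sym.
Qed.

Definition vhspan_id (x : X) : vhspan x x :=
  VHSpan (vertical_idm pi x) (cart_idm pi x).

Definition dual_id (x : X) : dual_hom x x := vhclass (vhspan_id x).

(* [s] is one of the spans (w.v1, k.h2) representing {(v1, h1)}.{(v2, h2)}. *)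
Definition vhspan_comp (x y z : X) (s1 : vhspan x y) (s2 : vhspan y z)
    (s : vhspan x z) : Prop :=
  exists (k : hom (apex s) (apex s2)) (w : hom (apex s) (apex s1)),
    [/\ over pi k (fmap pi (hleg s1)) /\ cartesian pi k,
        vertical pi w, w \; hleg s1 = k \; vleg s2,
        vleg s = w \; vleg s1 & hleg s = k \; hleg s2].

Lemma vhspan_comp_equiv (x y z : X) (s1 s1' : vhspan x y) (s2 s2' : vhspan y z)
    (s s' : vhspan x z) :
  vhspan_equiv s1 s1' -> vhspan_equiv s2 s2' ->
  vhspan_comp s1 s2 s -> vhspan_comp s1' s2' s' -> vhspan_equiv s s'.
Proof.
move=> [i1 [v1 iso1 e1v e1h]] [i2 [v2 iso2 e2v e2h]].
move=> [k [w [[kh kc] wv wk ev eh]]] [k' [w' [[k'h k'c] w'v w'k' ev' eh']]].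
have k'h1 : over pi (k' \; i2) (idm (pi (apex s1)) \; fmap pi (hleg s1)).
  rewrite comp1m; apply: over_verticalr => //.
  apply: over_trans (over_fmap _ (hleg s1')) _ k'h; rewrite -e1h.
  by apply: over_verticall => //; apply: over_fmap.
have [j jv jk] := cart_lift kc kh k'h1.
have {}jv : vertical pi j by exists (pi (apex s1)).
have jc : cartesian pi j.
  by apply: (cart_cancel _ kc); rewrite jk; apply: cart_comp => //; apply: cart_iso.
have jw : j \; w = w' \; i1.
  apply: (cart_inj (hlegP s1) (xi := idm (pi (apex s1)))).
  - by apply: vertical_cod; apply: vertical_comp.
  - by apply: vertical_cod; apply: vertical_comp.
  - by rewrite -!compmA wk e1h w'k' -e2v !compmA jk.
exists j; rewrite ev eh ev' eh'; split=> //.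
- exact: (cart_vertical_iso jv jc).
- by rewrite compmA jw -compmA e1v.
- by rewrite compmA jk -compmA e2h.
Qed.

Lemma vhspan_comp_closed (x y z : X) (s1 : vhspan x y) (s2 : vhspan y z)
    (s s' : vhspan x z) :
  vhspan_comp s1 s2 s -> vhspan_equiv s s' -> vhspan_comp s1 s2 s'.
Proof.
move=> [k [w [[kh kc] wv wk ev eh]]] [i [iv isoi ev' eh']].
exists (i \; k), (i \; w); rewrite -ev' -eh' ev eh -!compmA wk; split=> //.
  by split; [apply: over_verticall | apply: cart_comp => //; apply: cart_iso].
exact: vertical_comp.
Qed.

Hypothesis pi_fib : fibration pi.

Lemma vhspan_comp_ex (x y z : X) (s1 : vhspan x y) (s2 : vhspan y z) :
  exists s, vhspan_comp s1 s2 s.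
Proof.
have [e2' _] := over_ob (vertical_cod (vlegP s2)).
have [u [k [kh kc]]] := pi_fib (fmap pi (hleg s1)) e2'.
have kv : over pi (k \; vleg s2) (idm _ \; fmap pi (hleg s1)).
  by rewrite comp1m; apply: over_verticalr => //; apply: vlegP.
have [w wv wk] := cart_lift (hlegP s1) (over_fmap _ _) kv.
have {}wv : vertical pi w by exists (pi (apex s1)).
exists (VHSpan (vertical_comp wv (vlegP s1)) (cart_comp kc (hlegP s2))).
by exists k, w.
Qed.

Lemma dual_comp_subproof (x y z : X) (f : dual_hom x y) (g : dual_hom y z) :
  is_vhclass [set s | exists s1 s2,
    [/\ sval f s1, sval g s2 & vhspan_comp s1 s2 s]].
Proof.
have [t1 ->] := vhclassP f; have [t2 ->] := vhclassP g.
have [t tc] := vhspan_comp_ex t1 t2; exists t; apply/seteqP; split=> s /=.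
  by move=> [s1 [s2 [e1 e2]]]; apply: (vhspan_comp_equiv e1 e2 tc).
move=> ts; exists t1, t2; split; do ?exact: vhspan_equiv_refl.
exact: vhspan_comp_closed tc ts.
Qed.

Definition dual_comp (x y z : X) (f : dual_hom x y) (g : dual_hom y z) :
    dual_hom x z :=
  exist _ _ (dual_comp_subproof f g).

Lemma dual_compE (x y z : X) (s1 : vhspan x y) (s2 : vhspan y z)
    (s : vhspan x z) :
  vhspan_comp s1 s2 s -> dual_comp (vhclass s1) (vhclass s2) = vhclass s.
Proof.
move=> sc; apply: dual_hom_inj; apply/seteqP; split=> t /=.
  by move=> [t1 [t2 [e1 e2]]]; apply: (vhspan_comp_equiv e1 e2 sc).
move=> st; exists s1, s2; split; do ?exact: vhspan_equiv_refl.
exact: vhspan_comp_closed sc st.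
Qed.

Lemma dual_comp1m (x y : X) (f : dual_hom x y) : dual_comp (dual_id x) f = f.
Proof.
have [s ->] := vhclassP f; apply: dual_compE.
exists (idm _), (vleg s); rewrite /= !comp1m !compm1; split=> //.
  split; last exact: cart_idm.
  rewrite fmap1; have [<- _] := over_ob (vertical_cod (vlegP s)).
  exact: over_idm.
exact: vlegP.
Qed.

Lemma dual_compm1 (x y : X) (f : dual_hom x y) : dual_comp f (dual_id y) = f.
Proof.
have [s ->] := vhclassP f; apply: dual_compE.
exists (hleg s), (idm _); rewrite /= !comp1m !compm1; split=> //.
  by split; [apply: over_fmap | apply: hlegP].
exact: vertical_idm.
Qed.

Lemma dual_compA (x y z t : X)
    (f : dual_hom x y) (g : dual_hom y z) (h : dual_hom z t) :
  dual_comp f (dual_comp g h) = dual_comp (dual_comp f g) h.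
Proof.
have [s1 ->] := vhclassP f; have [s2 ->] := vhclassP g.
have [s3 ->] := vhclassP h.
have [s12 c12] := vhspan_comp_ex s1 s2; have [s23 c23] := vhspan_comp_ex s2 s3.
have [s c] := vhspan_comp_ex s12 s3.
rewrite (dual_compE c12) (dual_compE c23) (dual_compE c); apply: dual_compE.
move: c12 c23 c => [k12 [w12 [[k12h k12c] w12v wk12 ev12 eh12]]].
move=> [k23 [w23 [[k23h k23c] w23v wk23 ev23 eh23]]].
move=> [k [w [[kh kc] wv wk ev eh]]].
have [a ha] := over_hleg s2.
have kh' : over pi k (fmap pi (hleg s1) \; a).
  apply: over_trans (over_fmap _ (hleg s12)) _ kh.
  by rewrite eh12; apply: over_comp k12h ha.
have ka := over_trans (over_fmap _ _) ha k23h.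
have [k' k'h k'k] := cart_lift k23c ka kh'.
have k'c : cartesian pi k' by apply: (cart_cancel _ k23c); rewrite k'k.
have k'w : w \; k12 = k' \; w23.
  apply: (cart_inj (hlegP s2) (xi := fmap pi (hleg s1))).
  - exact: over_verticall.
  - exact: over_verticalr.
  - by rewrite -!compmA -eh12 wk wk23 compmA k'k.
exists k', (w \; w12); split=> //.
- exact: vertical_comp.
- by rewrite -compmA wk12 ev23 !compmA k'w.
- by rewrite ev ev12 compmA.
- by rewrite eh eh23 compmA k'k.
Qed.

Definition dual_category : category :=
  Category dual_comp1m dual_compm1 dual_compA.

(* pi^*({(v, h)}) is pi(h), read as an arrow with domain pi(x) = pi(apex). *)
Lemma dual_fmap_subproof (x y : X) (f : dual_hom x y) :
  exists a : hom (pi x) (pi y), exists2 s, sval f s & over pi (hleg s) a.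
Proof.
have [s ->] := vhclassP f.
have [a ha] := over_hleg s; exists a, s => //; exact: vhspan_equiv_refl.
Qed.

Definition dual_fmap (x y : X) (f : dual_hom x y) : hom (pi x) (pi y) :=
  sval (cid (dual_fmap_subproof f)).

Lemma dual_fmapP (x y : X) (s : vhspan x y) :
  over pi (hleg s) (dual_fmap (vhclass s)).
Proof.
rewrite /dual_fmap; case: cid => a /= [s' [i [iv _ _ <-]]] ha.
exact: over_trans (over_verticall iv (over_fmap _ _)) ha (over_fmap _ _).
Qed.

Lemma dual_fmap1 (x : X) : dual_fmap (dual_id x) = idm (pi x).
Proof. exact: (over_inj (dual_fmapP (vhspan_id x)) (over_idm pi x)). Qed.

Lemma dual_fmapM (x y z : X) (f : dual_hom x y) (g : dual_hom y z) :
  dual_fmap (dual_comp f g) = dual_fmap f \; dual_fmap g.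
Proof.
have [s1 ->] := vhclassP f; have [s2 ->] := vhclassP g.
have [s c] := vhspan_comp_ex s1 s2; rewrite (dual_compE c).
apply: (over_inj (dual_fmapP s)).
have [k [w [[kh _] _ _ _ ->]]] := c; apply: over_comp (dual_fmapP s2).
exact: over_trans (over_fmap _ _) (dual_fmapP s1) kh.
Qed.

Definition dual_functor : functor dual_category B :=
  @Functor dual_category B (fun x : X => pi x) dual_fmap dual_fmap1 dual_fmapM.

End FibrewiseDual.

(* Main.v *)
(** A cartesian lift of [a] along [pi^*] is the class of [(1, h)], where [h] is
    a cartesian lift of [a] along [pi].  Indeed composing [{(v, k)}] with
    [{(1, h)}] gives [{(v, k.h)}], so factoring [{(v, l)}] through [{(1, h)}]
    amounts to factoring the cartesian arrow [l] through [h], and the factor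
    is again cartesian. *)

From mathcomp Require Import all_boot.
Require Import Defs.

Set Implicit Arguments.
Unset Strict Implicit.
Unset Printing Implicit Defensive.

Local Open Scope category_scope.

Section DualFibration.
Variables (X B : category) (pi : functor X B) (pi_fib : fibration pi).

Let dual := dual_category pi_fib.

(** Any representative can be tested. The vertical leg puts the apex and [x] over the same object,
    so [a] is comparable with [dual_fmap]; both lie under [hleg s], hence agree. *)
Lemma over_vhclass (x y : X) (s : vhspan pi x y) (A A' : B) (a : hom A A') :
  over (dual_functor pi_fib) (vhclass s : @hom dual x y) a <->
  over pi (hleg s) a.
Proof.
split=> [[]|sa]; first exact: dual_fmapP.
have [uA yA'] := over_ob sa; have [ux _] := over_ob (vertical_cod (vlegP s)).
have xA : pi x = A by rewrite -ux uA.
case: A / xA a sa {uA} => a; case: A' / yA' a => a sa.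
rewrite (over_inj sa (dual_fmapP s)).
exact: (over_fmap (dual_functor pi_fib)).
Qed.

Definition horizontal_span (x y : X) (h : hom x y) (hc : cartesian pi h) :
  vhspan pi x y := VHSpan (vertical_idm pi x) hc.

(** The second span has an identity as vertical leg, so [hleg s] itself serves as the cartesian
    lift, with an identity as vertical comparison. *)
Lemma dual_comp_horizontal (x y z : X) (s : vhspan pi z x) (h : hom x y)
    (hc : cartesian pi h) :
  dual_comp pi_fib (vhclass s) (vhclass (horizontal_span hc)) =
  vhclass (VHSpan (vlegP s) (cart_comp (@hlegP _ _ _ _ _ s) hc)).
Proof.
apply: dual_compE; exists (hleg s), (idm _).
rewrite /= !comp1m compm1; split=> //; last exact: vertical_idm.
by split; [apply: over_fmap | exact: hlegP].
Qed.

Lemma dual_cartesian_horizontal (x y : X) (h : hom x y)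
    (hc : cartesian pi h) :
  cartesian (dual_functor pi_fib)
    (vhclass (horizontal_span hc) : @hom dual x y).
Proof.
have hE : fmap (dual_functor pi_fib)
    (vhclass (horizontal_span hc) : @hom dual x y) = fmap pi h.
  exact: over_inj (dual_fmapP (horizontal_span hc)) (over_fmap pi h).
apply: cartesianI => [C xi z g|C xi z f f'].
  rewrite hE; have [[u v l vv lc] ->] := vhclassP g.
  move=> /over_vhclass/= /(cart_lift hc (over_fmap pi h))[k kxi kh].
  have kc : cartesian pi k by apply: (cart_cancel _ hc); rewrite kh.
  exists (vhclass (VHSpan vv kc)); first exact/over_vhclass.
  rewrite [LHS]dual_comp_horizontal; apply/vhclass_eq.
  exists (idm u); rewrite /= !comp1m kh; split=> //; first exact: vertical_idm.
  by exists (idm u); rewrite comp1m.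
have [s ->] := vhclassP f; have [s' ->] := vhclassP f'.
move=> /over_vhclass sxi /over_vhclass s'xi.
rewrite [LHS]dual_comp_horizontal [RHS]dual_comp_horizontal.
(* The same [i] relates [s] to [s']: [i \; hleg s] and [hleg s'] both lie over [xi] and agree after
   composing with the cartesian [h]. *)
move=> /vhclass_eq[i /= [iv isoi ev eh]]; apply/vhclass_eq; exists i; split=> //.
apply: (cart_inj hc _ s'xi); first exact: over_verticall.
by rewrite -compmA.
Qed.

End DualFibration.

Theorem proposition3p3 (X B : category) (pi : functor X B)
    (pi_fib : fibration pi) : fibration (dual_functor pi_fib).
Proof.
move=> A A' a y yA'; have [x [h [ha hc]]] := pi_fib A A' a y yA'.
exists x, (vhclass (horizontal_span hc)); split; first exact/over_vhclass.
exact: dual_cartesian_horizontal.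
Qed.
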